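(* For all positive integers $a,b,\mu\in\mathbb{N}^{+}$, the sequence $n\mapsto \bar{M}(K_n;a,b)$ is ultimately periodic modulo $\mu$, where $\bar M$ is the bivariate matching polynomial and $K_n$ is the complete graph on $n$ vertices.
   Context: For a finite simple graph $G$ with $n$ vertices, let $m_k(G)$ be the number of matchings of size $k$ in $G$ (sets of $k$ pairwise vertex-disjoint edges). The bivariate matching polynomial is $$\bar{M}(G;X,Y)=\sum_{k=0}^{\lfloor n/2\rfloor}m_k(G)\,X^k\,Y^{n-2k}.$$ An integer sequence $(s_n)_{n\ge 1}$ is ultimately periodic modulo $\mu$ if there exist $N\ge 1$ and $p\ge 1$ such that $s_{n+p}\equiv s_n \pmod{\mu}$ for all $n\ge N$. *)

(* Defs.v *)
From mathcomp Require Import all_boot all_order all_algebra.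

Set Implicit Arguments.
Unset Strict Implicit.
Unset Printing Implicit Defensive.

Import GRing.Theory.
Local Open Scope ring_scope.

Record simple_graph := SimpleGraph {
  vertex : finType;
  adj : rel vertex;
  adj_sym : symmetric adj;
  adj_irrefl : irreflexive adj
}.

Definition edges (G : simple_graph) : {set {set vertex G}} :=
  [set [set u.1; u.2] | u : vertex G * vertex G & adj u.1 u.2].

Definition is_matching (G : simple_graph) (M : {set {set vertex G}}) : bool :=
  (M \subset edges G) && trivIset M.

Definition num_matchings (k : nat) (G : simple_graph) : nat :=
  #|[set M : {set {set vertex G}} | is_matching M && (#|M| == k)]|.

(* Both indeterminates are elements of {poly {poly int}}: 'X is the outer one
   and 'Y the inner one ('Y = 'X%:P), so that P.[a, b] substitutes a for 'X
   and b for 'Y. *)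
Definition matching_poly (G : simple_graph) : {poly {poly int}} :=
  let n := #|vertex G| in
  \sum_(0 <= k < n./2.+1) 'X ^+ k * 'Y ^+ (n - 2 * k) *+ num_matchings k G.

Definition complete_adj (n : nat) : rel 'I_n := fun x y => x != y.

Lemma complete_adj_sym (n : nat) : symmetric (@complete_adj n).
Proof. by move=> x y; rewrite /complete_adj eq_sym. Qed.

Lemma complete_adj_irrefl (n : nat) : irreflexive (@complete_adj n).
Proof. by move=> x; rewrite /complete_adj eqxx. Qed.

Definition complete_graph (n : nat) : simple_graph :=
  SimpleGraph (@complete_adj_sym n) (@complete_adj_irrefl n).

(* The sequence is indexed by n >= 1; the value at 0 is irrelevant. *)
Definition ultimately_periodic_mod (mu : nat) (s : nat -> int) : Prop :=
  exists N p : nat, [/\ (1 <= N)%N, (1 <= p)%N &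
    forall n : nat, (N <= n)%N -> (s (n + p)%N = s n %[mod mu])%Z].

(* Main.v *)
(** Sorting the matchings of [K_(n+2)] by the partner, if any, of one fixed
    vertex gives the recurrence
    [M (n+2) = b * M (n+1) + (n+1) * a * M n].  Its coefficients are periodic
    modulo [mu], so the triple of residues of [n], [M n] and [M (n+1)]
    determines the next triple; as there are finitely many triples, the
    pigeonhole principle makes them ultimately periodic. *)
Require Import Defs.
From mathcomp Require Import all_boot all_order all_algebra.
From mathcomp Require Import zify.

Import GRing.Theory.
Local Open Scope ring_scope.

Section Matchings.
Local Open Scope nat_scope.

(** Matchings of the complete graph on a subset [A] of a fixed type, so that deleting a vertex
    changes [A] and leaves the type alone. *)
Definition matchings {T : finType} (k : nat) (A : {set T}) : {set {set {set T}}} :=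
  [set M : {set {set T}} |
    [&& M \subset [set e : {set T} | (e \subset A) && (#|e| == 2)],
        trivIset M & #|M| == k]].

Lemma matchingsP {T : finType} {k : nat} {A : {set T}} {M : {set {set T}}} :
  reflect [/\ forall e, e \in M -> e \subset A /\ #|e| = 2,
              trivIset M & #|M| = k]
          (M \in matchings k A).
Proof.
rewrite inE; apply: (iffP and3P) => [[/subsetP sMA tM /eqP]|[sMA -> /eqP]].
  by split=> // e /sMA; rewrite inE => /andP[-> /eqP].
split=> //; apply/subsetP => e /sMA[eA e2].
by rewrite inE eA e2 eqxx.
Qed.

Lemma card_matchings0 {T : finType} (A : {set T}) : #|matchings 0 A| = 1.
Proof.
rewrite -(cards1 (set0 : {set {set T}})); apply: eq_card => M.
apply/matchingsP/set1P => [[_ _ /eqP]|->]; first by rewrite cards_eq0 => /eqP.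
split; rewrite ?cards0 //; first by move=> e; rewrite inE.
by apply/trivIsetP => B C; rewrite inE.
Qed.

Lemma card_matchings_set0 {T : finType} (k : nat) :
  #|matchings k.+1 (set0 : {set T})| = 0.
Proof.
apply/eqP; rewrite cards_eq0 -subset0; apply/subsetP => M /matchingsP[sM _ Mk].
have /card_gt0P[e /sM[]] : 0 < #|M| by rewrite Mk.
by rewrite subset0 => /eqP->; rewrite cards0.
Qed.

Lemma matchings_uncovered {T : finType} (k : nat) (A : {set T}) (x : T) :
  [set M in matchings k A | x \notin cover M] = matchings k (A :\ x).
Proof.
apply/setP => M; rewrite inE; apply/andP/matchingsP.
  case=> /matchingsP[sM tM Mk] xM; split=> // e eM; have [eA e2] := sM _ eM.
  by split=> //; rewrite subsetD1 eA; apply: contra xM => xe; apply/bigcupP; exists e.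
case=> sM tM Mk; split.
  apply/matchingsP; split=> // e /sM[eA e2]; split=> //.
  exact: subset_trans eA (subsetDl _ _).
by apply/bigcupP => -[e /sM[]]; rewrite subsetD1 => /andP[_ /negP].
Qed.

(** Adding the edge [[set x; y]] is a bijection: by disjointness, the other edges of a matching
    containing it avoid both [x] and [y]. *)
Lemma card_matchings_edge {T : finType} (k : nat) (A : {set T}) (x y : T) :
  x \in A -> y \in A :\ x ->
  #|[set M in matchings k.+1 A | [set x; y] \in M]| =
  #|matchings k (A :\ x :\ y)|.
Proof.
move=> xA; rewrite !inE => /andP[yx yA].
have xy2 : #|[set x; y]| = 2 by rewrite cards2 eq_sym yx.
have freshE M : M \in matchings k (A :\ x :\ y) -> [set x; y] \notin M.
  case/matchingsP=> sM _ _; apply/negP => /sM[/subsetP/(_ y)].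
  by rewrite !inE eqxx orbT => /(_ isT).
rewrite -(@card_in_imset _ _ (fun M => [set x; y] |: M) (matchings k (A :\ x :\ y))).
  apply: eq_card => M; rewrite inE; apply/andP/imsetP.
    case=> /matchingsP[sM tM Mk] xyM; exists (M :\ [set x; y]); last by rewrite setD1K.
    apply/matchingsP; split.
    - move=> e; rewrite !inE => /andP[exy eM]; have [eA e2] := sM _ eM; split=> //.
      have /trivIsetP/(_ _ _ eM xyM exy) := tM.
      rewrite disjoint_sym disjoints_subset => /subsetP dis.
      rewrite !subsetD1 eA /=.
      by have := dis x; have := dis y; rewrite !inE !eqxx orbT => -> // ->.
    - by apply: trivIsetS tM; apply: subsetDl.
    - by have := cardsD1 [set x; y] M; rewrite xyM Mk => -[].
  case=> M' M'm ->; have fr := freshE _ M'm.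
  have /matchingsP[sM tM Mk] := M'm; rewrite setU11; split=> //.
  have dis e : e \in M' -> [disjoint [set x; y] & e].
    case/sM; rewrite !subsetD1 => /andP[/andP[_ xe] ye] _.
    rewrite disjoints_subset; apply/subsetP => z.
    by rewrite !inE => /orP[] /eqP->.
  apply/matchingsP; split.
  - move=> e; rewrite in_setU1 => /orP[/eqP->|/sM[eA e2]].
      by split=> //; apply/subsetP => z; rewrite !inE => /orP[] /eqP->.
    by split=> //; move: eA; rewrite !subsetD1 => /andP[/andP[]].
  - apply/trivIsetP => B C; rewrite !in_setU1.
    move=> /orP[/eqP->|BM] /orP[/eqP->|CM]; first by rewrite eqxx.
    + by move=> _; apply: dis.
    + by move=> _; rewrite disjoint_sym; apply: dis.
    + by move/trivIsetP: tM; apply.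
  - by rewrite cardsU1 fr Mk.
by move=> M N /freshE Mf /freshE Nf /(congr1 (fun P => P :\ [set x; y])); rewrite !setU1K.
Qed.

(** Double counting of the pairs [(y, M)] with [[set x; y] \in M]: a matching that covers [x] gives
    [x] exactly one partner. *)
Lemma card_matchings_covered {T : finType} (k : nat) (A : {set T}) (x : T) :
  x \in A ->
  #|[set M in matchings k.+1 A | x \in cover M]| =
  \sum_(y in A :\ x) #|matchings k (A :\ x :\ y)|.
Proof.
move=> xA.
rewrite (eq_bigr (fun y => #|[set M in matchings k.+1 A | [set x; y] \in M]|));
  last by move=> y yA; rewrite card_matchings_edge.
rewrite -sum1_card.
under [RHS]eq_bigr do rewrite -sum1_card.
under [RHS]eq_bigr => y _ do under eq_bigl => M do rewrite inE.
rewrite (exchange_big_dep (mem (matchings k.+1 A))) /=; last by move=> y M _ /andP[].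
rewrite (eq_bigl (fun M => (M \in matchings k.+1 A) && (x \in cover M)));
  last by move=> M; rewrite inE.
(* For a fixed [M], the number of partners [y] of [x] has to be 1 if [x] is covered and 0
   otherwise. *)
rewrite big_mkcondr; apply: eq_bigr => M MA.
have /matchingsP[sM tM _] := MA.
case: ifPn => [/bigcupP[e eM xe]|xM]; last first.
  rewrite big1 // => y /andP[_ /andP[_ xyM]]; case/negP: xM.
  by apply/bigcupP; exists [set x; y]; rewrite ?inE ?eqxx.
have [eA e2] := sM _ eM.
have [y yx exy] : exists2 y, y != x & e = [set x; y].
  have /cards2P[u [v [uv ee]]] : #|e| == 2 by rewrite e2.
  have := xe; rewrite ee !inE => /orP[] /eqP->; last by exists u; rewrite // setUC.
  by exists v; rewrite // eq_sym.
rewrite (big_pred1 y) // => z /=; rewrite MA /= !inE.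
(* Uniqueness of the partner: two edges of [M] that share [x] coincide. *)
apply/andP/eqP => [[/andP[zx zA] xzM]|->].
  have ez : [set x; z] = e.
    apply/eqP/negPn/negP => ne; have /trivIsetP/(_ _ _ xzM eM ne) := tM.
    by rewrite disjoints_subset => /subsetP/(_ x); rewrite !inE eqxx xe => /(_ isT).
  have : z \in [set x; y] by rewrite -exy -ez !inE eqxx orbT.
  by rewrite !inE (negPf zx) => /eqP.
rewrite yx -exy eM; split=> //=.
by apply: (subsetP eA); rewrite exy !inE eqxx orbT.
Qed.

Lemma card_matchingsS {T : finType} (k : nat) (A : {set T}) (x : T) :
  x \in A ->
  #|matchings k.+1 A| = #|matchings k.+1 (A :\ x)| +
  \sum_(y in A :\ x) #|matchings k (A :\ x :\ y)|.
Proof.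
move=> xA; rewrite -card_matchings_covered // -matchings_uncovered addnC.
rewrite -(cardsID [set M | x \in cover M] (matchings k.+1 A)).
by congr (_ + _); apply: eq_card => M; rewrite !inE // andbC.
Qed.

(* Ordering the vertices, the [i]-th one is the largest covered vertex: it has
   [i] possible partners, and the remaining [k] edges avoid both. *)
Fixpoint matching_number (k n : nat) : nat :=
  if k is k'.+1 then \sum_(i < n) i * matching_number k' i.-1 else 1.

Arguments matching_number : simpl never.

Lemma matching_numberSS (k n : nat) :
  matching_number k.+1 n.+1 = matching_number k.+1 n + n * matching_number k n.-1.
Proof. exact: big_ord_recr. Qed.

(** There are too few vertices for [k] disjoint edges. In the recursive sum, the factor [i] kills
    the term [i = 0], and for [i > 0] the bound passes to [i.-1]. *)
Lemma matching_number_small (k n : nat) : n < 2 * k -> matching_number k n = 0.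
Proof.
elim: k n => [|k IHk] n // nk; apply: big1 => i _; rewrite -/matching_number.
have ltin := ltn_ord i.
by case: (posnP i) => [->|i0] //; rewrite IHk ?muln0 //; lia.
Qed.

Lemma card_matchings {T : finType} (k : nat) (A : {set T}) :
  #|matchings k A| = matching_number k #|A|.
Proof.
have [n] := ubnP #|A|; elim: n k A => // n IHn [|k] A ltAn.
  exact: card_matchings0.
have [->|[x xA]] := set_0Vmem A.
  by rewrite card_matchings_set0 cards0 /matching_number big_ord0.
have cA := cardsD1 x A; rewrite xA add1n in cA.
have ltAxn : #|A :\ x| < n by rewrite -ltnS -cA.
rewrite (card_matchingsS k A x xA) IHn // cA matching_numberSS.
(* By induction each summand depends only on the size of [A :\ x :\ y], which is the same for all
   [y]. *)
congr (_ + _); rewrite -sum_nat_const; apply: eq_bigr => y yA.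
have := cardsD1 y (A :\ x); rewrite yA add1n => cAx.
by rewrite IHn ?cAx // (leq_trans _ ltAxn) // cAx.
Qed.

Lemma edges_complete (n : nat) :
  edges (complete_graph n) = [set e : {set 'I_n} | #|e| == 2].
Proof.
apply/setP => e; rewrite inE; apply/imsetP/cards2P.
  by case=> -[x y]; rewrite inE => xy ->; exists x, y.
by case=> x [y [xy ->]]; exists (x, y); rewrite ?inE.
Qed.

Lemma num_matchings_complete (k n : nat) :
  num_matchings k (complete_graph n) = matching_number k n.
Proof.
rewrite -[in RHS](card_ord n) -cardsT -card_matchings.
apply: eq_card => M; rewrite !inE /is_matching edges_complete -andbA.
by congr (_ && _); apply: eq_subset_r => e; rewrite !inE subsetT.
Qed.

(** The value of the matching polynomial of the complete graph at [(a, b)], kept in [nat] for the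
    recurrence and the residues. *)
Definition matching_value (a b n : nat) : nat :=
  \sum_(k < n./2.+1) matching_number k n * (a ^ k * b ^ (n - 2 * k)).

Lemma matching_value_widen (a b n K : nat) : n./2 < K ->
  matching_value a b n =
  \sum_(k < K) matching_number k n * (a ^ k * b ^ (n - 2 * k)).
Proof.
move=> nK; rewrite /matching_value.
rewrite (big_ord_widen K (fun k => matching_number k n * (a ^ k * b ^ (n - 2 * k)))) //.
rewrite big_mkcond; apply: eq_bigr => k _; case: ltnP => // nk.
by rewrite matching_number_small //; lia.
Qed.

(** Holds term by term through [matching_numberSS]: leaving the last vertex uncovered costs a factor
    [b], matching it costs a factor [a] and one of [n.+1] partners. *)
Lemma matching_valueSS (a b n : nat) :
  matching_value a b n.+2 =
  b * matching_value a b n.+1 + n.+1 * a * matching_value a b n.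
Proof.
(* The ranges are chosen so that, once the [k = 0] terms of the first two sums are split off, all
   three sums have [n.+2] terms. *)
rewrite (@matching_value_widen _ _ n.+2 n.+3); last by lia.
rewrite (@matching_value_widen _ _ n.+1 n.+3); last by lia.
rewrite (@matching_value_widen _ _ n n.+2); last by lia.
rewrite big_ord_recl [in RHS]big_ord_recl mulnDr -addnA; congr (_ + _).
  by rewrite !muln0 !subn0 !mul1n expnS.
rewrite !big_distrr -big_split; apply: eq_bigr => k _.
rewrite !lift0 matching_numberSS /=.
have -> : n.+2 - 2 * k.+1 = n - 2 * k by lia.
rewrite mulnDl; congr (_ + _); last by rewrite expnS; lia.
(* Here truncated subtraction makes both exponents of [b] zero, so they do not differ by one; the
   vanishing matching number saves the identity. *)
case: (ltnP n.+1 (2 * k.+1)) => nk.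
  by rewrite matching_number_small // muln0.
have -> : n - 2 * k = (n.+1 - 2 * k.+1).+1 by lia.
by rewrite (expnS b); lia.
Qed.

End Matchings.

Lemma matching_poly_complete (a b n : nat) :
  (matching_poly (complete_graph n)).[a%:Z, b%:Z] = (matching_value a b n)%:Z.
Proof.
rewrite /matching_poly /= card_ord big_mkord /matching_value -[RHS]natz natr_sum.
rewrite !horner_sum; apply: eq_bigr => k _.
rewrite num_matchings_complete !hornerE hornerMn !hornerE hornerMn !hornerE.
by rewrite natrM natrM !natrX mulr_natl !natz mulrnAl.
Qed.

Section Periodicity.
Local Open Scope nat_scope.

(** Two of the first [#|T|.+1] terms agree, say at [i < j]; the hypothesis carries the agreement
    forward, giving period [j - i] from [i] on. *)
Lemma finite_orbit_periodic (T : finType) (s : nat -> T) :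
  (forall i j, s i = s j -> s i.+1 = s j.+1) ->
  exists N p, 0 < p /\ forall n, N <= n -> s (n + p) = s n.
Proof.
move=> sS; have [/injectiveP inj|/injectivePn[i [j ij sij]]] :=
  boolP (injectiveb (fun i : 'I_#|T|.+1 => s i)).
  by have := leq_card _ inj; rewrite card_ord ltnn.
wlog lt_ij : i j ij sij / i < j.
  move=> H; have [|ji|/val_inj eij] := ltngtP i j; first exact: H.
    by apply: (H j i) => //; rewrite eq_sym.
  by rewrite eij eqxx in ij.
exists i, (j - i); split=> [|n le_in]; first by rewrite subn_gt0.
rewrite -(subnK le_in) -addnA subnKC 1?ltnW //.
by elim: (n - i) => [|m IHm]; rewrite ?add0n ?addSn //; apply: sS.
Qed.

Lemma matching_value_periodic (a b mu : nat) : 0 < mu ->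
  exists N p, 0 < p /\
    forall n, N <= n -> matching_value a b (n + p) = matching_value a b n %[mod mu].
Proof.
(* Residues are taken in the finite type ['I_m.+1], so that the states form a [finType]. *)
case: mu => // m _; pose r k : 'I_m.+1 := inZp k.
have rP i j : r i = r j <-> i = j %[mod m.+1].
  by split=> [/(congr1 val)|ij] //; apply: val_inj.
pose s n := (r n, r (matching_value a b n), r (matching_value a b n.+1)).
have sS i j : s i = s j -> s i.+1 = s j.+1.
  case=> ij vij vSij.
  have ijS : i.+1 = j.+1 %[mod m.+1] by rewrite -addn1 -modnDml ij modnDml addn1.
  congr (_, _, _); apply/rP => //; rewrite !matching_valueSS.
  rewrite -modnDm -[in RHS]modnDm; congr ((_ + _) %% _).
    by rewrite -modnMmr vSij modnMmr.
  rewrite -modnMm -[in RHS]modnMm vij; congr (_ * _ %% _).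
  by rewrite -modnMml ijS modnMml.
have [N [p [p0 sp]]] := finite_orbit_periodic _ _ sS.
by exists N, p; split=> // n /sp[].
Qed.

End Periodicity.

Theorem theorem1p8 (a b mu : nat) (ha : (0 < a)%N) (hb : (0 < b)%N)
    (hmu : (0 < mu)%N) :
  ultimately_periodic_mod mu
    (fun n : nat => (matching_poly (complete_graph n)).[a%:Z, b%:Z]).
Proof.
have [N [p [p0 vp]]] := @matching_value_periodic a b mu hmu.
(* The successor makes the threshold positive, as the definition demands. *)
exists N.+1, p; split=> // n /ltnW/vp vnp.
by rewrite !matching_poly_complete !modz_nat vnp.
Qed.
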